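(* Let $\mathbf{w}^0,\mathbf{w}^1,\ldots,\mathbf{w}^N\in\mathbf{H}$ be the solution of the scheme of the alternating-triangular method, written in factorized form as $$\Big(\mathbf{I}+\frac{\tau}{2}\mathbf{A}_1\Big)\Big(\mathbf{I}+\frac{\tau}{2}\mathbf{A}_2\Big)\frac{\mathbf{w}^{n+1}-\mathbf{w}^{n}}{\tau}+\mathbf{A}\mathbf{w}^n=\boldsymbol{\varphi}^{n+1/2},\quad n=0,1,\ldots,N-1,\qquad \mathbf{w}^0=\mathbf{v}^0,$$ where $\mathbf{A}=\mathbf{A}_1+\mathbf{A}_2$, $\mathbf{A}_1^*=\mathbf{A}_2$ is the triangular splitting of $\mathbf{A}$. Then the scheme is unconditionally stable: without any restriction on the time step $\tau$, the estimate $$\|\mathbf{w}^{n+1}\|_{\mathbf{A}}^2\le\|\mathbf{v}^0\|_{\mathbf{A}}^2+\frac12\sum_{k=0}^{n}\tau\|\boldsymbol{\varphi}^{k+1/2}\|^2,\quad n=0,1,\ldots,N-1,$$ holds for the difference solution.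
   Context: Grid problem. Let $l_1,l_2,T>0$, $\Omega=(0,l_1)\times(0,l_2)$, and let $k,c:\Omega\to\mathbb{R}$ satisfy $0<k_1\le k\le k_2$, $0<c_1\le c\le c_2$ with constants $k_1,k_2,c_1,c_2$. For positive integers $N_1,N_2$ put $h_d=l_d/N_d$ and $\omega=\{((i-0.5)h_1,(j-0.5)h_2): 1\le i\le N_1,\ 1\le j\le N_2\}$. $H$ is the finite-dimensional real Hilbert space of grid functions on $\omega$ with $(y,v)=\sum_{x\in\omega}y(x)v(x)h_1h_2$, $\|v\|=(v,v)^{1/2}$. With $e_1=(1,0)$, $e_2=(0,1)$, the operator $A:H\to H$ is $A=A^{(1)}+A^{(2)}$, where for $d=1,2$ $$(A^{(d)}v)(x)=-\frac{1}{h_d^2}k(x+0.5h_de_d)\big(v(x+h_de_d)-v(x)\big)+\frac{1}{h_d^2}k(x-0.5h_de_d)\big(v(x)-v(x-h_de_d)\big)+\frac12c(x)v(x),$$ the first term being omitted when $x_d=l_d-0.5h_d$ and the second when $x_d=0.5h_d$ (homogeneous Neumann boundary conditions). It satisfies $A=A^*\ge\delta I$ with $\delta=c_1$. Given $v^0\in H$ and $\varphi:[0,T]\to H$, the problem to be approximated is $\frac{dv}{dt}+Av=\varphi(t)$, $0<t\le T$, $v(0)=v^0$. Solution decomposition. Let $H_1,\ldots,H_p$ be finite-dimensional Hilbert spaces with scalar products $(\cdot,\cdot)_\alpha$, and let $R_\alpha:H\to H_\alpha$ be linear (restriction) operators with adjoints (extension operators) $R_\alpha^*:H_\alpha\to H$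 such that $\sum_{\alpha=1}^pR_\alpha^*R_\alpha=I$. Let $\mathbf{H}=H_1\oplus\cdots\oplus H_p$ with $(\mathbf{v},\mathbf{y})=\sum_{\alpha=1}^p(v_\alpha,y_\alpha)_\alpha$, $\|\mathbf{v}\|=(\mathbf{v},\mathbf{v})^{1/2}$, and identity operator $\mathbf{I}$. The operator matrix $\mathbf{A}:\mathbf{H}\to\mathbf{H}$ is $\mathbf{A}=\{R_\alpha AR_\beta^*\}_{\alpha,\beta=1}^p$, i.e. $(\mathbf{A}\mathbf{v})_\alpha=\sum_{\beta=1}^pR_\alpha AR_\beta^*v_\beta$, and $\|\mathbf{v}\|_{\mathbf{A}}=(\mathbf{A}\mathbf{v},\mathbf{v})^{1/2}$. Triangular splitting: $\mathbf{A}_1$ is the lower triangular operator matrix with entries $R_\alpha AR_\beta^*$ for $\alpha>\beta$, $\frac12R_\alpha AR_\alpha^*$ for $\alpha=\beta$, and $0$ for $\alpha<\beta$; $\mathbf{A}_2$ is the upper triangular operator matrix with entries $R_\alpha AR_\beta^*$ for $\alpha<\beta$, $\frac12R_\alpha AR_\alpha^*$ for $\alpha=\beta$, and $0$ for $\alpha>\beta$. Put $\mathbf{v}^0=\{R_1v^0,\ldots,R_pv^0\}$ and $\boldsymbol{\varphi}(t)=\{R_1\varphi(t),\ldots,R_p\varphi(t)\}$. Time grid. $N$ is a positive integer, $\tau=T/N$, $t^n=n\tau$, $\boldsymbol{\varphi}^n=\boldsymbol{\varphi}(t^n)$, $\boldsymbol{\varphi}^{n+1/2}=\frac12(\boldsymbol{\varphi}^{n+1}+\boldsymbol{\varphi}^n)$.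 *)

(* Defs.v *)
From HB Require Import structures.
From mathcomp Require Import all_boot all_order all_algebra.
From mathcomp Require Import reals.

Set Implicit Arguments.
Unset Strict Implicit.
Unset Printing Implicit Defensive.

Import Order.TTheory GRing.Theory Num.Theory.
Local Open Scope ring_scope.

(* A grid function on the N1 x N2 cell-centred grid is a matrix v : 'M[R]_(N1, N2);
   the zero-based entry v i j is the value at ((i + 1/2) h1, (j + 1/2) h2). *)

Definition grid_step (R : realType) (l : R) (n : nat) : R := l / n%:R.

Definition grid_node (R : realType) (h : R) (i : nat) : R :=
  (i.+1%:R - 2^-1) * h.

Definition grid_dot (R : realType) (N1 N2 : nat) (l1 l2 : R)
    (y v : 'M[R]_(N1, N2)) : R :=
  \sum_(i < N1) \sum_(j < N2)
    y i j * v i j * grid_step l1 N1 * grid_step l2 N2.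

(* Each of the two sums has at most one term, the one for the right (left)
   neighbour i' of i.  It is empty at the last (first) node, where the Neumann
   condition drops the corresponding flux. *)
Definition neumann_diff (R : realType) (n : nat) (h : R) (kappa : R -> R)
    (u : 'I_n -> R) (i : 'I_n) : R :=
  - (h ^- 2 * \sum_(i' < n | i' == i.+1 :> nat)
       kappa (grid_node h i + 2^-1 * h) * (u i' - u i))
  + h ^- 2 * \sum_(i' < n | i'.+1 == i :> nat)
       kappa (grid_node h i - 2^-1 * h) * (u i - u i').

Definition grid_op1 (R : realType) (N1 N2 : nat) (l1 l2 : R)
    (k c : R -> R -> R) (v : 'M[R]_(N1, N2)) : 'M[R]_(N1, N2) :=
  let h1 := grid_step l1 N1 in let h2 := grid_step l2 N2 in
  \matrix_(i, j)
    (neumann_diff h1 (fun x1 => k x1 (grid_node h2 j)) (fun i' => v i' j) i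
     + 2^-1 * c (grid_node h1 i) (grid_node h2 j) * v i j).

Definition grid_op2 (R : realType) (N1 N2 : nat) (l1 l2 : R)
    (k c : R -> R -> R) (v : 'M[R]_(N1, N2)) : 'M[R]_(N1, N2) :=
  let h1 := grid_step l1 N1 in let h2 := grid_step l2 N2 in
  \matrix_(i, j)
    (neumann_diff h2 (fun x2 => k (grid_node h1 i) x2) (fun j' => v i j') j
     + 2^-1 * c (grid_node h1 i) (grid_node h2 j) * v i j).

Definition grid_op (R : realType) (N1 N2 : nat) (l1 l2 : R)
    (k c : R -> R -> R) : 'M[R]_(N1, N2) -> 'M[R]_(N1, N2) :=
  grid_op1 l1 l2 k c \+ grid_op2 l1 l2 k c.

(* An alias is needed because the library gives dependent finite functions no
   additive or module structure. *)
Definition dsum (R : realType) (p : nat) (U : 'I_p -> vectType R) : Type :=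
  {dffun forall a : 'I_p, U a}.

HB.instance Definition _ (R : realType) (p : nat) (U : 'I_p -> vectType R) :=
  Choice.copy (dsum U) {dffun forall a : 'I_p, U a}.

Definition dsum_coord (R : realType) (p : nat) (U : 'I_p -> vectType R)
    (v : dsum U) (a : 'I_p) : U a := (v : {dffun forall a : 'I_p, U a}) a.

Definition mk_dsum (R : realType) (p : nat) (U : 'I_p -> vectType R)
    (f : forall a : 'I_p, U a) : dsum U := [ffun a => f a].

Lemma mk_dsumE (R : realType) (p : nat) (U : 'I_p -> vectType R)
    (f : forall a : 'I_p, U a) (a : 'I_p) : dsum_coord (mk_dsum f) a = f a.
Proof. by rewrite /dsum_coord /mk_dsum ffunE. Qed.

Lemma dsumP (R : realType) (p : nat) (U : 'I_p -> vectType R) (u v : dsum U) :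
  (forall a, dsum_coord u a = dsum_coord v a) -> u = v.
Proof. by move=> uv; apply/ffunP => a; apply: uv. Qed.

Definition dsum_zero (R : realType) (p : nat) (U : 'I_p -> vectType R) :
  dsum U := mk_dsum (fun a => 0).
Definition dsum_opp (R : realType) (p : nat) (U : 'I_p -> vectType R)
    (u : dsum U) : dsum U := mk_dsum (fun a => - dsum_coord u a).
Definition dsum_add (R : realType) (p : nat) (U : 'I_p -> vectType R)
    (u v : dsum U) : dsum U :=
  mk_dsum (fun a => dsum_coord u a + dsum_coord v a).
Definition dsum_scale (R : realType) (p : nat) (U : 'I_p -> vectType R)
    (x : R) (u : dsum U) : dsum U := mk_dsum (fun a => x *: dsum_coord u a).

Fact dsum_addA (R : realType) (p : nat) (U : 'I_p -> vectType R) :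
  associative (@dsum_add R p U).
Proof. by move=> u v w; apply: dsumP => a; rewrite !mk_dsumE addrA. Qed.
Fact dsum_addC (R : realType) (p : nat) (U : 'I_p -> vectType R) :
  commutative (@dsum_add R p U).
Proof. by move=> u v; apply: dsumP => a; rewrite !mk_dsumE addrC. Qed.
Fact dsum_add0 (R : realType) (p : nat) (U : 'I_p -> vectType R) :
  left_id (dsum_zero U) (@dsum_add R p U).
Proof. by move=> u; apply: dsumP => a; rewrite !mk_dsumE add0r. Qed.
Fact dsum_addN (R : realType) (p : nat) (U : 'I_p -> vectType R) :
  left_inverse (dsum_zero U) (@dsum_opp R p U) (@dsum_add R p U).
Proof. by move=> u; apply: dsumP => a; rewrite !mk_dsumE addNr. Qed.

HB.instance Definition _ (R : realType) (p : nat) (U : 'I_p -> vectType R) :=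
  GRing.isZmodule.Build (dsum U) (@dsum_addA R p U) (@dsum_addC R p U)
    (@dsum_add0 R p U) (@dsum_addN R p U).

Fact dsum_scaleA (R : realType) (p : nat) (U : 'I_p -> vectType R)
    (x y : R) (u : dsum U) :
  dsum_scale x (dsum_scale y u) = dsum_scale (x * y) u.
Proof. by apply: dsumP => a; rewrite !mk_dsumE scalerA. Qed.
Fact dsum_scale1 (R : realType) (p : nat) (U : 'I_p -> vectType R) :
  left_id 1 (@dsum_scale R p U).
Proof. by move=> u; apply: dsumP => a; rewrite !mk_dsumE scale1r. Qed.
Fact dsum_scaleDr (R : realType) (p : nat) (U : 'I_p -> vectType R) :
  right_distributive (@dsum_scale R p U) +%R.
Proof. by move=> x u v; apply: dsumP => a; rewrite !mk_dsumE scalerDr. Qed.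
Fact dsum_scaleDl (R : realType) (p : nat) (U : 'I_p -> vectType R)
    (u : dsum U) : {morph (@dsum_scale R p U)^~ u : x y / x + y}.
Proof. by move=> x y; apply: dsumP => a; rewrite !mk_dsumE scalerDl. Qed.

HB.instance Definition _ (R : realType) (p : nat) (U : 'I_p -> vectType R) :=
  GRing.Zmodule_isLmodule.Build R (dsum U) (@dsum_scaleA R p U)
    (@dsum_scale1 R p U) (@dsum_scaleDr R p U) (@dsum_scaleDl R p U).

(* Over a real field, {dot V for idfun} is the type of symmetric positive definite
   bilinear forms, i.e. real scalar products. *)
Definition dsum_dot (R : realType) (p : nat) (U : 'I_p -> vectType R)
    (dot : forall a : 'I_p, {dot (U a) for idfun}) (v y : dsum U) : R :=
  \sum_(a < p) dot a (dsum_coord v a) (dsum_coord y a).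

Definition dsum_norm (R : realType) (p : nat) (U : 'I_p -> vectType R)
    (dot : forall a : 'I_p, {dot (U a) for idfun}) (v : dsum U) : R :=
  Num.sqrt (dsum_dot dot v v).

Definition energy_norm (R : realType) (p : nat) (U : 'I_p -> vectType R)
    (dot : forall a : 'I_p, {dot (U a) for idfun}) (B : dsum U -> dsum U)
    (v : dsum U) : R :=
  Num.sqrt (dsum_dot dot (B v) v).

Definition opmx (R : realType) (p : nat) (U : 'I_p -> vectType R)
    (M : forall a b : 'I_p, U b -> U a) (v : dsum U) : dsum U :=
  mk_dsum (fun a => \sum_(b < p) M a b (dsum_coord v b)).

Definition block_op (R : realType) (V : lmodType R) (p : nat)
    (U : 'I_p -> vectType R) (Res : forall a : 'I_p, {linear V -> U a})
    (Ext : forall a : 'I_p, {linear U a -> V}) (A : V -> V) :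
    dsum U -> dsum U :=
  opmx (fun a b u => Res a (A (Ext b u))).

Definition block_lower (R : realType) (V : lmodType R) (p : nat)
    (U : 'I_p -> vectType R) (Res : forall a : 'I_p, {linear V -> U a})
    (Ext : forall a : 'I_p, {linear U a -> V}) (A : V -> V) :
    dsum U -> dsum U :=
  opmx (fun a b u => if (b < a)%N then Res a (A (Ext b u))
                     else if a == b then 2^-1 *: Res a (A (Ext b u))
                     else 0).

Definition block_upper (R : realType) (V : lmodType R) (p : nat)
    (U : 'I_p -> vectType R) (Res : forall a : 'I_p, {linear V -> U a})
    (Ext : forall a : 'I_p, {linear U a -> V}) (A : V -> V) :
    dsum U -> dsum U :=
  opmx (fun a b u => if (a < b)%N then Res a (A (Ext b u))
                     else if a == b then 2^-1 *: Res a (A (Ext b u))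
                     else 0).

Definition decompose (R : realType) (V : lmodType R) (p : nat)
    (U : 'I_p -> vectType R) (Res : forall a : 'I_p, {linear V -> U a})
    (v : V) : dsum U :=
  mk_dsum (fun a => Res a v).

Definition half_step (R : realType) (V : lmodType R) (tau : R) (f : R -> V)
    (n : nat) : V :=
  2^-1 *: (f (n.+1%:R * tau) + f (n%:R * tau)).

(* Main.v *)
(* Put z = (w^{n+1} - w^n) / tau.  Since A_1^* = A_2, the scalar product of the
   scheme with 2 tau z is the energy identity
     2 tau |z|^2 + tau^3 / 2 |A_2 z|^2 + |w^{n+1}|_A^2 - |w^n|_A^2
       = 2 tau (phi^{n+1/2}, z),
   and 2 (phi, z) <= 2 |z|^2 + |phi|^2 / 2 bounds the energy growth in one step
   by tau / 2 |phi^{n+1/2}|^2.  Nonnegativity of the block operator reduces to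
   that of the grid operator: (bold A v, v) = (A s, s) with
   s = sum_a R_a^* v_a. *)

Require Import Defs.
From HB Require Import structures.
From mathcomp Require Import all_boot all_order all_algebra.
From mathcomp Require Import reals.
From mathcomp Require Import ring lra.

Set Implicit Arguments.
Unset Strict Implicit.
Unset Printing Implicit Defensive.

Import Order.TTheory GRing.Theory Num.Theory.
Local Open Scope ring_scope.

Lemma symC (R : realType) (V : lmodType R) (f : {symmetric V}) (u v : V) :
  f u v = f v u.
Proof. by rewrite hermC expr0 mul1r. Qed.

Lemma dot_ge0 (R : realType) (V : lmodType R) (f : {dot V for idfun}) (u : V) :
  0 <= f u u.
Proof.
by have [->|/neq0_dnorm_gt0/ltW//] := eqVneq u 0; rewrite linear0l.
Qed.

(** * Nodes and cell faces of a grid line, and the Neumann difference operator on it *)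

Lemma grid_node_half_step (R : realType) (h : R) (i : nat) :
  grid_node h i + 2^-1 * h = i.+1%:R * h.
Proof. by rewrite /grid_node; field. Qed.

(** The bounds on [k] and [c] are assumed only in the open rectangle, so every point where a
    coefficient is evaluated has to be located strictly inside. *)
Lemma grid_node_itv (R : realType) (l : R) (n i : nat) :
  0 < l -> (i < n)%N -> 0 < grid_node (grid_step l n) i < l.
Proof.
move=> l0 lt_in.
have n0 : 0 < n%:R :> R by rewrite ltr0n (leq_ltn_trans _ lt_in).
have h0 : 0 < grid_step l n by rewrite divr_gt0.
have lE : l = n%:R * grid_step l n by rewrite mulrC divfK ?gt_eqF.
have iN : i.+1%:R <= n%:R :> R by rewrite ler_nat.
(* Only the right-hand bound becomes [n] times the step; the [l] inside the steps stays, and the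
   factor [h] can be cancelled. *)
rewrite {3}lE /grid_node mulr_gt0 ?ltr_pM2r //=.
  by apply: lt_le_trans iN; lra.
by rewrite -natr1; have := ler0n R i; lra.
Qed.

(** With [i.+1 < n] the face separates two nodes; the right face of the last node would lie on the
    boundary. *)
Lemma grid_face_itv (R : realType) (l : R) (n i : nat) :
  0 < l -> (i.+1 < n)%N ->
  0 < grid_node (grid_step l n) i + 2^-1 * grid_step l n < l.
Proof.
move=> l0 lt_in; rewrite grid_node_half_step.
have n0 : 0 < n%:R :> R by rewrite ltr0n (leq_ltn_trans _ lt_in).
have h0 : 0 < grid_step l n by rewrite divr_gt0.
have lE : l = n%:R * grid_step l n by rewrite mulrC divfK ?gt_eqF.
by rewrite {3}lE mulr_gt0 ?ltr0n // ltr_pM2r // ltr_nat.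
Qed.

(** The discrete Dirichlet form. Interior faces are indexed by their left node [i]; the inner sum is
    empty at the last node. *)
Definition neumann_form (R : realType) (n : nat) (h : R) (kappa : R -> R)
    (u y : 'I_n -> R) : R :=
  h ^- 2 * \sum_(i < n) \sum_(i' < n | i' == i.+1 :> nat)
    kappa (grid_node h i + 2^-1 * h) * ((u i' - u i) * (y i' - y i)).

Lemma neumann_formC (R : realType) (n : nat) (h : R) (kappa : R -> R)
    (u y : 'I_n -> R) :
  neumann_form h kappa u y = neumann_form h kappa y u.
Proof.
by congr (_ * _); apply: eq_bigr => i _; apply: eq_bigr => i' _; ring.
Qed.

Lemma neumann_form_ge0 (R : realType) (n : nat) (h : R) (kappa : R -> R)
    (u : 'I_n -> R) :
  (forall i, (i.+1 < n)%N -> 0 <= kappa (grid_node h i + 2^-1 * h)) ->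
  0 <= neumann_form h kappa u u.
Proof.
move=> kappa0; rewrite mulr_ge0 ?invr_ge0 ?sqr_ge0 // sumr_ge0 // => i _.
rewrite sumr_ge0 // => i' /eqP i'E.
by rewrite mulr_ge0 -?expr2 ?sqr_ge0 // kappa0 // -i'E.
Qed.

(* Summation by parts: the fluxes through the two faces of a node are paired up
   face by face, and the boundary terms vanish by the Neumann condition. *)
Lemma sum_neumann_diff (R : realType) (n : nat) (h : R) (kappa : R -> R)
    (u y : 'I_n -> R) :
  \sum_(i < n) neumann_diff h kappa u i * y i = neumann_form h kappa u y.
Proof.
rewrite /neumann_diff /neumann_form.
under eq_bigr => i _ do rewrite mulrDl mulNr -!mulrA !mulr_suml.
rewrite big_split sumrN /= -!mulr_sumr -mulrN -mulrDr; congr (_ * _).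
(* The left-face fluxes are re-indexed by the left neighbour, so that both sums run over the same
   faces. *)
rewrite [X in _ + X](exchange_big_dep predT) //= -sumrN -big_split /=.
apply: eq_bigr => i _; rewrite -sumrN.
rewrite [X in _ + X](eq_bigl (fun i' : 'I_n => i' == i.+1 :> nat));
  last by move=> i' /=; rewrite eq_sym.
rewrite -big_split /=; apply: eq_bigr => i' /eqP i'E.
have -> : grid_node h i' - 2^-1 * h = grid_node h i + 2^-1 * h.
  by rewrite grid_node_half_step i'E /grid_node -[i.+2%:R]natr1; field.
ring.
Qed.

Lemma neumann_diff_is_linear (R : realType) (n : nat) (h : R)
    (kappa : R -> R) (x : R) (u v : 'I_n -> R) (i : 'I_n) :
  neumann_diff h kappa (fun i' => x * u i' + v i') i =
  x * neumann_diff h kappa u i + neumann_diff h kappa v i.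
Proof.
rewrite /neumann_diff.
have lin (P : pred 'I_n) (a b b' : 'I_n -> R) :
    (forall i', a i' = x * b i' + b' i') ->
    \sum_(i' | P i') a i' =
    x * (\sum_(i' | P i') b i') + \sum_(i' | P i') b' i'.
  by move=> aE; rewrite mulr_sumr -big_split; apply: eq_bigr.
rewrite [X in - (_ * X) + _](lin _ _
    (fun i' => kappa (grid_node h i + 2^-1 * h) * (u i' - u i))
    (fun i' => kappa (grid_node h i + 2^-1 * h) * (v i' - v i))); last first.
  by move=> i'; ring.
rewrite [X in _ + _ * X = _](lin _ _
    (fun i' => kappa (grid_node h i - 2^-1 * h) * (u i - u i'))
    (fun i' => kappa (grid_node h i - 2^-1 * h) * (v i - v i'))); last first.
  by move=> i'; ring.
ring.
Qed.

(** Replaces functional extensionality when matrix entries are expanded under the binder. *)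
Lemma eq_neumann_diff (R : realType) (n : nat) (h : R)
    (kappa : R -> R) (u v : 'I_n -> R) (i : 'I_n) :
  u =1 v -> neumann_diff h kappa u i = neumann_diff h kappa v i.
Proof.
by move=> uv; rewrite /neumann_diff; congr (- (_ * _) + _ * _);
  apply: eq_bigr => i' _; rewrite !uv.
Qed.

(** * The grid operator: linearity, symmetry and nonnegativity *)

Fact grid_op_is_linear (R : realType) (N1 N2 : nat) (l1 l2 : R)
    (k c : R -> R -> R) : linear (@grid_op R N1 N2 l1 l2 k c).
Proof.
move=> x u v; apply/matrixP => i j; rewrite !mxE.
rewrite (@eq_neumann_diff _ _ _ _ _ (fun i' => x * u i' j + v i' j));
  last by move=> i'; rewrite !mxE.
rewrite [X in _ + (X + _)](@eq_neumann_diff _ _ _ _ _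
  (fun j' => x * u i j' + v i j')); last by move=> j'; rewrite !mxE.
by rewrite !neumann_diff_is_linear; ring.
Qed.

HB.instance Definition _ (R : realType) (N1 N2 : nat) (l1 l2 : R)
    (k c : R -> R -> R) :=
  GRing.isLinear.Build R _ _ _ (@grid_op R N1 N2 l1 l2 k c)
    (@grid_op_is_linear R N1 N2 l1 l2 k c).

Lemma grid_dotC (R : realType) (N1 N2 : nat) (l1 l2 : R)
    (y v : 'M[R]_(N1, N2)) : grid_dot l1 l2 y v = grid_dot l1 l2 v y.
Proof.
by apply: eq_bigr => i _; apply: eq_bigr => j _; rewrite [y i j * _]mulrC.
Qed.

Fact grid_dot_linearl (R : realType) (N1 N2 : nat) (l1 l2 : R)
    (y : 'M[R]_(N1, N2)) : linear_for *%R ((grid_dot l1 l2)^~ y).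
Proof.
move=> x u v; rewrite /grid_dot mulr_sumr -big_split; apply: eq_bigr => i _.
by rewrite mulr_sumr -big_split; apply: eq_bigr => j _; rewrite !mxE /=; ring.
Qed.

Fact grid_dot_bilinear (R : realType) (N1 N2 : nat) (l1 l2 : R) :
  bilinear_for *%R (idfun \; *%R) (@grid_dot R N1 N2 l1 l2).
Proof.
split=> [|y x u v]; first exact: grid_dot_linearl.
by rewrite ![grid_dot _ _ y _]grid_dotC grid_dot_linearl.
Qed.

HB.instance Definition _ (R : realType) (N1 N2 : nat) (l1 l2 : R) :=
  bilinear_isBilinear.Build R _ _ R *%R (idfun \; *%R)
    (@grid_dot R N1 N2 l1 l2) (@grid_dot_bilinear R N1 N2 l1 l2).

Fact grid_dot_hermitian (R : realType) (N1 N2 : nat) (l1 l2 : R)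
    (y v : 'M[R]_(N1, N2)) :
  grid_dot l1 l2 y v = (-1) ^+ false * idfun (grid_dot l1 l2 v y).
Proof. by rewrite expr0 mul1r grid_dotC. Qed.

HB.instance Definition _ (R : realType) (N1 N2 : nat) (l1 l2 : R) :=
  isHermitianSesquilinear.Build R _ false idfun
    (@grid_dot R N1 N2 l1 l2) (@grid_dot_hermitian R N1 N2 l1 l2).

(** Summation by parts along every grid line of either direction; the two halves of the [c] term add
    up. Symmetry and sign of the operator can be read off the right-hand side. *)
Lemma grid_dot_grid_op (R : realType) (N1 N2 : nat) (l1 l2 : R)
    (k c : R -> R -> R) (v y : 'M[R]_(N1, N2)) :
  let h1 := grid_step l1 N1 in let h2 := grid_step l2 N2 in
  grid_dot l1 l2 (grid_op l1 l2 k c v) y =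
  (\sum_(j < N2) neumann_form h1 (fun x1 => k x1 (grid_node h2 j))
      (fun i => v i j) (fun i => y i j)
   + \sum_(i < N1) neumann_form h2 (fun x2 => k (grid_node h1 i) x2)
      (fun j => v i j) (fun j => y i j)
   + \sum_(i < N1) \sum_(j < N2)
      c (grid_node h1 i) (grid_node h2 j) * (v i j * y i j)) * (h1 * h2).
Proof.
move=> h1 h2.
under [X in X + _ + _]eq_bigr => j _ do rewrite -sum_neumann_diff.
under [X in _ + X + _]eq_bigr => i _ do rewrite -sum_neumann_diff.
rewrite [X in X + _ + _]exchange_big -!big_split mulr_suml /grid_dot.
apply: eq_bigr => i _; rewrite -!big_split mulr_suml; apply: eq_bigr => j _.
by rewrite !mxE /= -/h1 -/h2; field.
Qed.

Lemma grid_op_self_adjoint (R : realType) (N1 N2 : nat) (l1 l2 : R)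
    (k c : R -> R -> R) (v y : 'M[R]_(N1, N2)) :
  grid_dot l1 l2 (grid_op l1 l2 k c v) y =
  grid_dot l1 l2 v (grid_op l1 l2 k c y).
Proof.
rewrite [RHS]grid_dotC !grid_dot_grid_op; congr ((_ + _ + _) * _).
- by apply: eq_bigr => j _; rewrite neumann_formC.
- by apply: eq_bigr => i _; rewrite neumann_formC.
- by apply: eq_bigr => i _; apply: eq_bigr => j _; rewrite [v i j * _]mulrC.
Qed.

Lemma grid_op_ge0 (R : realType) (N1 N2 : nat) (l1 l2 : R)
    (k c : R -> R -> R) (v : 'M[R]_(N1, N2)) :
  0 < l1 -> 0 < l2 ->
  (forall x1 x2, 0 < x1 < l1 -> 0 < x2 < l2 -> 0 <= k x1 x2) ->
  (forall x1 x2, 0 < x1 < l1 -> 0 < x2 < l2 -> 0 <= c x1 x2) ->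
  0 <= grid_dot l1 l2 (grid_op l1 l2 k c v) v.
Proof.
move=> l1_gt0 l2_gt0 k_ge0 c_ge0; rewrite grid_dot_grid_op.
apply: mulr_ge0; last by rewrite !mulr_ge0 ?invr_ge0 ?ler0n ?ltW.
rewrite !addr_ge0 ?sumr_ge0 // => i _.
- by apply: neumann_form_ge0 => j ltj;
    rewrite k_ge0 ?grid_face_itv ?grid_node_itv.
- by apply: neumann_form_ge0 => j ltj;
    rewrite k_ge0 ?grid_face_itv ?grid_node_itv.
- rewrite sumr_ge0 // => j _.
  by rewrite mulr_ge0 -?expr2 ?sqr_ge0 ?c_ge0 ?grid_node_itv.
Qed.

(** * The direct sum as a space with scalar product *)

Section DirectSum.

Variables (R : realType) (p : nat) (U : 'I_p -> vectType R).

Lemma dsum_coordD (u v : dsum U) (a : 'I_p) :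
  dsum_coord (u + v) a = dsum_coord u a + dsum_coord v a.
Proof. by rewrite mk_dsumE. Qed.

Lemma dsum_coordB (u v : dsum U) (a : 'I_p) :
  dsum_coord (u - v) a = dsum_coord u a - dsum_coord v a.
Proof. by rewrite dsum_coordD mk_dsumE. Qed.

Lemma dsum_coordZ (x : R) (u : dsum U) (a : 'I_p) :
  dsum_coord (x *: u) a = x *: dsum_coord u a.
Proof. by rewrite mk_dsumE. Qed.

Variable dot : forall a : 'I_p, {dot (U a) for idfun}.

Fact dsum_dot_zmod_morphisml (y : dsum U) :
  zmod_morphism ((dsum_dot dot)^~ y).
Proof.
by move=> u v; rewrite /dsum_dot -sumrB; apply: eq_bigr => a _;
  rewrite dsum_coordB linearBl.
Qed.

Fact dsum_dot_zmod_morphismr (y : dsum U) : zmod_morphism (dsum_dot dot y).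
Proof.
by move=> u v; rewrite /dsum_dot -sumrB; apply: eq_bigr => a _;
  rewrite dsum_coordB linearBr.
Qed.

Fact dsum_dot_scalablel (y : dsum U) :
  scalable_for *%R ((dsum_dot dot)^~ y).
Proof.
by move=> x u; rewrite /dsum_dot mulr_sumr; apply: eq_bigr => a _;
  rewrite dsum_coordZ linearZl_LR.
Qed.

Fact dsum_dot_scalabler (y : dsum U) :
  scalable_for (idfun \; *%R) (dsum_dot dot y).
Proof.
by move=> x u; rewrite /dsum_dot /= mulr_sumr; apply: eq_bigr => a _;
  rewrite dsum_coordZ linearZr_LR.
Qed.

HB.instance Definition _ :=
  isBilinear.Build R (dsum U) (dsum U) R *%R (idfun \; *%R) (dsum_dot dot)
    dsum_dot_zmod_morphisml dsum_dot_zmod_morphismr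
    dsum_dot_scalablel dsum_dot_scalabler.

Fact dsum_dot_hermitian (u v : dsum U) :
  dsum_dot dot u v = (-1) ^+ false * idfun (dsum_dot dot v u).
Proof. by rewrite expr0 mul1r; apply: eq_bigr => a _; rewrite symC. Qed.

HB.instance Definition _ :=
  isHermitianSesquilinear.Build R (dsum U) false idfun (dsum_dot dot)
    dsum_dot_hermitian.

(** A vanishing sum of nonnegative squares forces every component to vanish. Definiteness makes
    [dsum_dot] a [{dot}] form, as the one-step energy estimate requires. *)
Fact dsum_dot_gt0 (u : dsum U) : u != 0 -> 0 < dsum_dot dot u u.
Proof.
move=> u_neq0.
rewrite lt0r sumr_ge0 ?andbT => [|a _]; last exact: dot_ge0.
apply: contra u_neq0; rewrite psumr_eq0 => [|a _]; last exact: dot_ge0.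
move=> /allP dot0; apply/eqP/dsumP => a.
rewrite mk_dsumE; apply: contraTeq (dot0 a (mem_index_enum a)) => ua_neq0.
by rewrite /= gt_eqF // neq0_dnorm_gt0.
Qed.

HB.instance Definition _ :=
  isDotProduct.Build R (dsum U) (dsum_dot dot) dsum_dot_gt0.

Lemma opmx_is_linear (M : forall a b : 'I_p, U b -> U a) :
  (forall a b, linear (M a b)) -> linear (opmx M).
Proof.
move=> linM x u v; apply: dsumP => a.
rewrite dsum_coordD dsum_coordZ !mk_dsumE scaler_sumr -big_split.
by apply: eq_bigr => b _; rewrite dsum_coordD dsum_coordZ linM.
Qed.

Lemma opmx_adjoint (M M' : forall a b : 'I_p, U b -> U a) (u v : dsum U) :
  (forall a b x y, dot a (M a b x) y = dot b x (M' b a y)) ->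
  dsum_dot dot (opmx M u) v = dsum_dot dot u (opmx M' v).
Proof.
move=> adjM; rewrite /dsum_dot.
under eq_bigr => a _ do rewrite mk_dsumE linear_sumlz.
under [RHS]eq_bigr => a _ do rewrite mk_dsumE linear_sumr.
rewrite exchange_big; apply: eq_bigr => b _; apply: eq_bigr => a _.
exact: adjM.
Qed.

End DirectSum.

(** * Block operators and their triangular splitting *)

Section BlockOperators.

Variables (R : realType) (V : lmodType R) (p : nat) (U : 'I_p -> vectType R).
Variables (Res : forall a : 'I_p, {linear V -> U a}).
Variables (Ext : forall a : 'I_p, {linear U a -> V}).
Variable A : {linear V -> V}.

Fact block_lower_is_linear : linear (block_lower Res Ext A).
Proof.
apply: opmx_is_linear => a b x u v.
case: ifP => _; first by rewrite !linearP.
case: ifP => _; first by rewrite !linearP.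
by rewrite scaler0 addr0.
Qed.

HB.instance Definition _ :=
  GRing.isLinear.Build R _ _ _ (block_lower Res Ext A) block_lower_is_linear.

Fact block_upper_is_linear : linear (block_upper Res Ext A).
Proof.
apply: opmx_is_linear => a b x u v.
case: ifP => _; first by rewrite !linearP.
case: ifP => _; first by rewrite !linearP.
by rewrite scaler0 addr0.
Qed.

HB.instance Definition _ :=
  GRing.isLinear.Build R _ _ _ (block_upper Res Ext A) block_upper_is_linear.

Lemma block_opE (v : dsum U) :
  block_op Res Ext A v = block_lower Res Ext A v + block_upper Res Ext A v.
Proof.
apply: dsumP => a; rewrite dsum_coordD !mk_dsumE -big_split.
apply: eq_bigr => b _; rewrite -val_eqE /=.
case: (ltngtP a b) => _; rewrite ?addr0 ?add0r //.
(* On the diagonal the two halves add up to the full block. *)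
by rewrite -scalerDl [_ + _](_ : _ = 1) ?scale1r //; field.
Qed.

Variable dot : forall a : 'I_p, {dot (U a) for idfun}.
Variable g : {symmetric V}.
Hypothesis Res_adjoint : forall (a : 'I_p) (v : V) (y : U a),
  dot a (Res a v) y = g v (Ext a y).

(** The adjoint of block (a, b) of the operator matrix is block (b, a), because [A] is symmetric and
    [Ext] is adjoint to [Res]; transposition exchanges the two triangles. *)
Lemma block_lower_adjoint (u v : dsum U) :
  (forall x y, g (A x) y = g x (A y)) ->
  dsum_dot dot (block_lower Res Ext A u) v =
  dsum_dot dot u (block_upper Res Ext A v).
Proof.
move=> adjA; apply: opmx_adjoint => a b x y.
have blockC : dot a (Res a (A (Ext b x))) y = dot b x (Res b (A (Ext a y))).
  by rewrite Res_adjoint adjA symC -Res_adjoint symC.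
rewrite [b == a]eq_sym.
case: ifP => _ //; case: ifP => _; last by rewrite linear0l linear0r.
by rewrite linearZl_LR linearZr_LR /= blockC.
Qed.

Lemma dsum_dot_block_op (v : dsum U) :
  let s := \sum_(a < p) Ext a (dsum_coord v a) in
  dsum_dot dot (block_op Res Ext A v) v = g (A s) s.
Proof.
rewrite /= [in RHS]linear_sumr; apply: eq_bigr => a _.
rewrite -[RHS]Res_adjoint mk_dsumE; congr (dot a _ _).
by rewrite !linear_sum.
Qed.

End BlockOperators.

(** * Energy estimate for one time step *)

Lemma alternating_triangular_step (R : realType) (V : lmodType R)
    (dot : {dot V for idfun}) (A1 A2 : {linear V -> V}) (tau : R) (x x' f : V) :
  0 < tau -> (forall u v, dot (A1 u) v = dot u (A2 v)) ->
  ((idfun \+ (tau / 2) \*: A1) \o (idfun \+ (tau / 2) \*: A2))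
    (tau^-1 *: (x' - x)) + (A1 x + A2 x) = f ->
  dot (A1 x' + A2 x') x' <= dot (A1 x + A2 x) x + tau / 2 * dot f f.
Proof.
move=> tau_gt0 adj; set z := tau^-1 *: (x' - x) => /= fE.
have dotC u v : dot u v = dot v u by exact: symC.
have x'E : x' = x + tau *: z.
  by rewrite /z scalerA divff ?gt_eqF // scale1r addrC subrK.
clearbody z.
(* Restated because the library rules leave the form under other projections
   (of Bilinear), which blocks rewriting with [dotC] and [adj]. *)
have dotDl u v y : dot (u + v) y = dot u y + dot v y by exact: linearDl.
have dotZl a u y : dot (a *: u) y = a * dot u y by exact: linearZl_LR.
have dotDr u v y : dot y (u + v) = dot y u + dot y v by exact: linearDr.
have dotZr a u y : dot y (a *: u) = a * dot y u by exact: linearZr_LR.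
(* Every [A1] is moved across the form to an [A2]: the product of the two factors contributes the
   square of [A2 z], and [dot (A1 z) z] equals [dot (A2 z) z]. *)
have fz : dot f z = dot z z + tau * dot (A2 z) z
    + tau ^+ 2 / 4 * dot (A2 z) (A2 z) + dot (A2 z) x + dot (A2 x) z.
  rewrite -fE /= !(linearD, linearZ) /= !(dotDl, dotZl) !adj.
  by rewrite !(dotC z) (dotC x); field.
have energyE : dot (A1 x' + A2 x') x' =
    dot (A1 x + A2 x) x + 2 * tau * (dot (A2 z) x + dot (A2 x) z)
    + 2 * tau ^+ 2 * dot (A2 z) z.
  rewrite x'E !(linearD, linearZ) /= !(dotDl, dotZl, dotDr, dotZr) !adj.
  by rewrite !(dotC z) !(dotC x); ring.
(* The square of [f - 2 z]; the factor 2 makes the [dot z z] term cancel exactly against the one in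
   [fz]. *)
have sq_ge0 : 0 <= dot f f - 4 * dot f z + 4 * dot z z.
  have := dot_ge0 dot (f + (- 2) *: z).
  rewrite !(dotDl, dotZl, dotDr, dotZr) (dotC z f).
  by move=> sq_ge0; lra.
(* [lra] treats nonlinear monomials as atoms, so the products with powers of [tau] are supplied
   beforehand. *)
have {}sq_ge0 := mulr_ge0 (ltW tau_gt0) sq_ge0.
have : 0 <= tau ^+ 3 * dot (A2 z) (A2 z).
  by rewrite mulr_ge0 ?dot_ge0 ?exprn_ge0 ?(ltW tau_gt0).
by rewrite fz in sq_ge0; rewrite energyE -addrA lerD2l; lra.
Qed.

Theorem theorem4 (R : realType)
  (l1 l2 T : R) (hl1 : 0 < l1) (hl2 : 0 < l2) (hT : 0 < T)
  (k c : R -> R -> R) (k1 k2 c1 c2 : R) (hk1 : 0 < k1) (hc1 : 0 < c1)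
  (hk : forall x1 x2 : R, 0 < x1 < l1 -> 0 < x2 < l2 -> k1 <= k x1 x2 <= k2)
  (hc : forall x1 x2 : R, 0 < x1 < l1 -> 0 < x2 < l2 -> c1 <= c x1 x2 <= c2)
  (N1 N2 : nat) (hN1 : (0 < N1)%N) (hN2 : (0 < N2)%N)
  (v0 : 'M[R]_(N1, N2)) (phi : R -> 'M[R]_(N1, N2))
  (p : nat) (U : 'I_p -> vectType R)
  (dot : forall a : 'I_p, {dot (U a) for idfun})
  (Res : forall a : 'I_p, {linear 'M[R]_(N1, N2) -> U a})
  (Ext : forall a : 'I_p, {linear U a -> 'M[R]_(N1, N2)})
  (hadj : forall (a : 'I_p) (v : 'M[R]_(N1, N2)) (y : U a),
    dot a (Res a v) y = grid_dot l1 l2 v (Ext a y))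
  (hsum : forall v : 'M[R]_(N1, N2), \sum_(a < p) Ext a (Res a v) = v)
  (N : nat) (hN : (0 < N)%N) (w : nat -> dsum U) :
  let tau := T / N%:R in
  let A := grid_op l1 l2 k c in
  let bA := block_op Res Ext A in
  let bA1 := block_lower Res Ext A in
  let bA2 := block_upper Res Ext A in
  let bv0 := decompose Res v0 in
  let bphi (t : R) := decompose Res (phi t) in
  w 0%N = bv0 ->
  (forall n : nat, (n < N)%N ->
    ((idfun \+ (tau / 2) \*: bA1) \o (idfun \+ (tau / 2) \*: bA2))
      (tau^-1 *: (w n.+1 - w n)) + bA (w n) = half_step tau bphi n) ->
  forall n : nat, (n < N)%N ->
    energy_norm dot bA (w n.+1) ^+ 2 <=
      energy_norm dot bA bv0 ^+ 2
      + 2^-1 * \sum_(0 <= m < n.+1) tau * dsum_norm dot (half_step tau bphi m) ^+ 2.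
Proof.
move=> tau A bA bA1 bA2 bv0 bphi w0 wS.
have tau_gt0 : 0 < tau by rewrite divr_gt0 // ltr0n.
(* [Num.sqrt] is 0 on negative numbers, so the squared energy norm equals the quadratic form only
   once the latter is known to be nonnegative. *)
have bA_ge0 u : 0 <= dsum_dot dot (bA u) u.
  rewrite (dsum_dot_block_op _ hadj) grid_op_ge0 // => x1 x2 x1P x2P.
    by have /andP[k_ge _] := hk _ _ x1P x2P; rewrite (le_trans _ k_ge) ?ltW.
  by have /andP[c_ge _] := hc _ _ x1P x2P; rewrite (le_trans _ c_ge) ?ltW.
have step n : (n < N)%N -> energy_norm dot bA (w n.+1) ^+ 2 <=
    energy_norm dot bA (w n) ^+ 2
    + 2^-1 * (tau * dsum_norm dot (half_step tau bphi n) ^+ 2).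
  move=> ltnN; rewrite !sqr_sqrtr ?dot_ge0 // mulrA [2^-1 * tau]mulrC.
  rewrite /bA !block_opE; apply: alternating_triangular_step => //.
    move=> u v; apply: (block_lower_adjoint hadj) => y y'.
    exact: grid_op_self_adjoint.
  by rewrite -(wS _ ltnN) -block_opE.
elim=> [|n IHn] ltnN.
  by rewrite big_nat1 -w0 step.
rewrite big_nat_recr //= mulrDr addrA.
by apply: le_trans (step _ ltnN) _; rewrite lerD2r IHn // ltnW.
Qed.
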